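(* Suppose that Assumptions A, B and C-1 (stated in the context) hold. Let $\{(x^r,y^r)\}$ be a sequence generated by the HiBSA algorithm with $U_y(u;x,y)=\langle\nabla_y f(x,y),u-y\rangle-\frac{1}{2\rho}\|u-y\|^2$, with $\gamma^r=0$ and $\beta^r=\beta>0$ for all $r$, where $\rho$ and $\beta$ satisfy $$\rho<\frac{\theta}{4L_y^2},\qquad \beta> L_y^2\left(\frac{2}{\theta^2\rho}+\frac{\rho}{2}\right)+\frac{L_{x_i}}{2}-\mu_i,\quad \forall\, i.$$ For a given $\epsilon>0$ let $$T(\epsilon):=\min\{r \mid \|\nabla\mathcal{G}^{\beta}_{\rho}(x^{r+1},y^{r+1})\|\le\epsilon,\ r\ge 1\}.$$ Then $T(\epsilon)=\mathcal{O}\left(\frac{1}{\epsilon^2}\right)$ (with a constant independent of $\epsilon$).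
   Context: Problem. $\min_x\max_y \ell(x,y):=f(x_1,\dots,x_K,y)+\sum_{i=1}^K h_i(x_i)-g(y)$ subject to $x_i\in\mathcal{X}_i$ ($i=1,\dots,K$), $y\in\mathcal{Y}$, with $x=[x_1;\dots;x_K]\in\mathbb{R}^{NK}$, $x_i\in\mathbb{R}^N$, $y\in\mathbb{R}^M$, $\mathcal{X}=\mathcal{X}_1\times\dots\times\mathcal{X}_K$. $\|\cdot\|$ is the Euclidean norm; $x_{-i}$ denotes $x$ with block $i$ removed; $[K]=\{1,\dots,K\}$. Assumption A. (A.1) $f:\mathbb{R}^{KN+M}\to\mathbb{R}$ is continuously differentiable; $\mathcal{X}_i$ and $\mathcal{Y}$ are convex and compact; $\ell(x,y)\ge\underline{\ell}$ for all $x\in\mathcal{X},y\in\mathcal{Y}$. (A.2) $h_i:\mathbb{R}^N\to\mathbb{R}$ and $g:\mathbb{R}^M\to\mathbb{R}$ are convex (possibly non-smooth). (A.3) For all $z,\bar z\in\mathcal{X}\times\mathcal{Y}$: $\|\nabla_{x_i}f(\bar z)-\nabla_{x_i}f(z)\|\le L_{x_i}\|\bar z-z\|$ for every $i$, and $\|\nabla_y f(\bar z)-\nabla_y f(z)\|\le L_y\|\bar z-z\|$. Assumption B (approximation functions $U_i(\cdot;w,y):\mathbb{R}^N\to\mathbb{R}$). (B.1) Each $U_i(\cdot;w,y)$ is strongly convex with modulus $\mu_i>0$: $U_i(x_i;w,y)-U_i(z_i;w,y)\ge\langle\nabla_{z_i}U_i(z_i;w,y),x_i-z_i\rangle+\frac{\mu_i}{2}\|x_i-z_i\|^2$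 for all $w\in\mathcal{X},y\in\mathcal{Y},x_i,z_i\in\mathcal{X}_i$. (B.2) $\nabla_{z_i}U_i(z_i;x,y)|_{z_i=x_i}=\nabla_{x_i}f(x,y)$ for all $i$, $x\in\mathcal{X},y\in\mathcal{Y}$. (B.3) $U_i(z_i;x,y)\ge f(z_i,x_{-i},y)$ and $U_i(x_i;x,y)=f(x,y)$ for all $x\in\mathcal{X},y\in\mathcal{Y},z_i\in\mathcal{X}_i$. (B.4) $\|\nabla U_i(z_i;w,y)-\nabla U_i(v_i;w,y)\|\le L_{u_i}\|v_i-z_i\|$ (gradient in the first argument) for all $w\in\mathcal{X},y\in\mathcal{Y},v_i,z_i\in\mathcal{X}_i$. Assumption C-1. For any $x\in\mathcal{X}$ and all $y,z\in\mathcal{Y}$: $f(x,z)-f(x,y)\le\langle\nabla_y f(x,y),z-y\rangle-\frac{\theta}{2}\|z-y\|^2$, where $\theta>1$; and $U_y(u;x,y)=\langle\nabla_y f(x,y),u-y\rangle-\frac{1}{2\rho}\|u-y\|^2$ for a fixed constant $\rho>0$. HiBSA algorithm. From a starting point $(x^1,y^1)\in\mathcal{X}\times\mathcal{Y}$, at each iteration $r=1,2,\dots$: for $i=1,\dots,K$ in order, with $w_i^{r+1}:=[x_1^{r+1};\dots;x_{i-1}^{r+1};x_i^r;\dots;x_K^r]$, $$x_i^{r+1}=\arg\min_{x_i\in\mathcal{X}_i}U_i(x_i;w_i^{r+1},y^r)+h_i(x_i)+\frac{\beta^r}{2}\|x_i-x_i^r\|^2;$$ then $y^{r+1}=\arg\max_{y\in\mathcal{Y}}U_y(y;x^{r+1},y^r)-g(y)-\frac{\gamma^r}{2}\|y\|^2$.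 Stationarity gap. $\mathrm{Px}_i^{\beta}(v_i):=\arg\min_{x_i\in\mathcal{X}_i}h_i(x_i)+\frac{\beta}{2}\|x_i-v_i\|^2$, $\mathrm{Py}^{1/\rho}(w):=\arg\max_{y\in\mathcal{Y}}-g(y)-\frac{1}{2\rho}\|y-w\|^2$. $\nabla\mathcal{G}^{\beta}_{\rho}(x,y)$ (a symbol, not a gradient) is the stacked vector with blocks $\beta\big(x_i-\mathrm{Px}_i^{\beta}(x_i-\frac1\beta\nabla_{x_i}f(x,y))\big)$, $i=1,\dots,K$, and last block $\frac1\rho\big(y-\mathrm{Py}^{1/\rho}(y+\rho\nabla_y f(x,y))\big)$. *)

(* Defs.v *)
From HB Require Import structures.
From mathcomp Require Import all_boot all_order all_algebra.
From mathcomp Require Import all_classical all_reals all_analysis.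

Set Implicit Arguments.
Unset Strict Implicit.
Unset Printing Implicit Defensive.

Import Order.TTheory GRing.Theory Num.Theory.
Import numFieldNormedType.Exports.

Local Open Scope classical_set_scope.
Local Open Scope ring_scope.

(* The block vector x = [x_1; ...; x_K] of R^{NK} is the K x N matrix whose    *)
(* i-th row is x_i, and z = (x, y) is a pair.  The library norm `|_| on        *)
(* matrices and pairs is a sup norm: it supplies only the topology and the     *)
(* derivatives (which do not depend on the choice of norm), while every        *)
(* quantitative statement uses the Euclidean norms enorm and pnorm.            *)

Section Euclidean.
Variable R : realType.

Definition dotv n (u v : 'rV[R]_n) : R := \sum_(k < n) u 0 k * v 0 k.

Definition enorm m n (A : 'M[R]_(m, n)) : R :=
  Num.sqrt (\sum_(i < m) \sum_(k < n) A i k ^+ 2).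

Definition pnorm m n p (z : 'M[R]_(m, n) * 'rV[R]_p) : R :=
  Num.sqrt (enorm z.1 ^+ 2 + enorm z.2 ^+ 2).

Definition grad n (F : 'rV[R]_n -> R) (p : 'rV[R]_n) : 'rV[R]_n :=
  \row_k 'D_(delta_mx 0 k) F p.

Definition argmin (T : Type) (A : set T) (F : T -> R) : set T :=
  [set a | A a /\ forall b, A b -> F a <= F b].

Definition argmax (T : Type) (A : set T) (F : T -> R) : set T :=
  [set a | A a /\ forall b, A b -> F b <= F a].

End Euclidean.

Definition least (P : set nat) (t : nat) : Prop :=
  P t /\ forall r, P r -> (t <= r)%N.

Section MinMax.
Variables (R : realType) (K N M : nat).
Implicit Types (X : 'I_K -> set 'rV[R]_N) (Y : set 'rV[R]_M).
Implicit Types (f : 'M[R]_(K, N) * 'rV[R]_M -> R).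
Implicit Types (h : 'I_K -> 'rV[R]_N -> R) (g : 'rV[R]_M -> R).
Implicit Types (U : 'I_K -> 'rV[R]_N -> 'M[R]_(K, N) -> 'rV[R]_M -> R).
Implicit Types (Uy : 'rV[R]_M -> 'M[R]_(K, N) -> 'rV[R]_M -> R).
Implicit Types (x : 'M[R]_(K, N)) (y : 'rV[R]_M).

Definition prodset X : set 'M[R]_(K, N) := [set x | forall i, X i (row i x)].

(* (z_i, x_{-i}) *)
Definition setblock x (i : 'I_K) (z : 'rV[R]_N) : 'M[R]_(K, N) :=
  \matrix_(j, k) (if j == i then z 0 k else x j k).

(* [x'_1; ...; x'_{i-1}; x_i; ...; x_K] *)
Definition mixblock (x' x : 'M[R]_(K, N)) (i : 'I_K) : 'M[R]_(K, N) :=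
  \matrix_(j, k) (if (j < i)%N then x' j k else x j k).

Definition gradx f (i : 'I_K) x y : 'rV[R]_N :=
  grad (fun z => f (setblock x i z, y)) (row i x).

Definition grady f x y : 'rV[R]_M := grad (fun v => f (x, v)) y.

Definition objective f h g x y : R :=
  f (x, y) + \sum_(i < K) h i (row i x) - g y.

Record assumptionA X Y f h g (Lx : 'I_K -> R) (Ly : R) : Prop := {
  A1_diff : forall z, differentiable f z ;
  A1_contx : forall i, continuous (fun z => gradx f i z.1 z.2) ;
  A1_conty : continuous (fun z => grady f z.1 z.2) ;
  A1_convexX : forall i, convex_set (X i) ;
  A1_compactX : forall i, compact (X i) ;
  A1_convexY : convex_set Y ;
  A1_compactY : compact Y ;
  A1_lower : exists l : R, forall x y,
    prodset X x -> Y y -> l <= objective f h g x y ;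
  A2_h : forall i, convex_function setT (h i) ;
  A2_g : convex_function setT g ;
  A3_x : forall x x' y y',
    prodset X x -> prodset X x' -> Y y -> Y y' -> forall i,
    enorm (gradx f i x' y' - gradx f i x y)
      <= Lx i * pnorm ((x', y') - (x, y)) ;
  A3_y : forall x x' y y',
    prodset X x -> prodset X x' -> Y y -> Y y' ->
    enorm (grady f x' y' - grady f x y) <= Ly * pnorm ((x', y') - (x, y))
}.

(* B_diff is implicit in the use of the gradient of U_i(.; w, y) on X_i.       *)
Record assumptionB X Y f U (mu Lu : 'I_K -> R) : Prop := {
  B_diff : forall i w y z, prodset X w -> Y y -> X i z ->
    differentiable (fun u => U i u w y) z ;
  B1_mu : forall i, 0 < mu i ;
  B1 : forall i w y u z, prodset X w -> Y y -> X i u -> X i z ->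
    dotv (grad (fun v => U i v w y) z) (u - z)
      + mu i / 2 * enorm (u - z) ^+ 2 <= U i u w y - U i z w y ;
  B2 : forall i x y, prodset X x -> Y y ->
    grad (fun v => U i v x y) (row i x) = gradx f i x y ;
  B3_upper : forall i x y z, prodset X x -> Y y -> X i z ->
    f (setblock x i z, y) <= U i z x y ;
  B3_eq : forall i x y, prodset X x -> Y y -> U i (row i x) x y = f (x, y) ;
  B4 : forall i w y v z, prodset X w -> Y y -> X i v -> X i z ->
    enorm (grad (fun u => U i u w y) z - grad (fun u => U i u w y) v)
      <= Lu i * enorm (v - z)
}.

Record assumptionC1 X Y f (theta rho : R) : Prop := {
  C1_theta : 1 < theta ;
  C1_rho : 0 < rho ;
  C1_concave : forall x y z, prodset X x -> Y y -> Y z ->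
    f (x, z) - f (x, y)
      <= dotv (grady f x y) (z - y) - theta / 2 * enorm (z - y) ^+ 2
}.

Definition Uy_C1 f (rho : R) (u : 'rV[R]_M) x y : R :=
  dotv (grady f x y) (u - y) - 1 / (2 * rho) * enorm (u - y) ^+ 2.

(* Iterations are numbered from 1: xs 0 and ys 0 are irrelevant. *)
Record HiBSA X Y h g U Uy (beta gamma : nat -> R)
    (xs : nat -> 'M[R]_(K, N)) (ys : nat -> 'rV[R]_M) : Prop := {
  HiBSA_startx : prodset X (xs 1%N) ;
  HiBSA_starty : Y (ys 1%N) ;
  HiBSA_x : forall r, (1 <= r)%N -> forall i,
    argmin (X i)
      (fun z => U i z (mixblock (xs r.+1) (xs r) i) (ys r) + h i z
                + beta r / 2 * enorm (z - row i (xs r)) ^+ 2)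
      (row i (xs r.+1)) ;
  HiBSA_y : forall r, (1 <= r)%N ->
    argmax Y
      (fun v => Uy v (xs r.+1) (ys r) - g v - gamma r / 2 * enorm v ^+ 2)
      (ys r.+1)
}.

(* Under the assumptions the two proximal problems have exactly one solution,  *)
(* which get selects.                                                          *)
Definition Px X h (beta : R) (i : 'I_K) (v : 'rV[R]_N) : 'rV[R]_N :=
  get (argmin (X i) (fun z => h i z + beta / 2 * enorm (z - v) ^+ 2)).

Definition Py Y g (rho : R) (w : 'rV[R]_M) : 'rV[R]_M :=
  get (argmax Y (fun v => - g v - 1 / (2 * rho) * enorm (v - w) ^+ 2)).

Definition gap X Y f h g (beta rho : R) x y : 'M[R]_(K, N) * 'rV[R]_M :=
  (\matrix_(i, k)
     (beta *: (row i x - Px X h beta i (row i x - beta^-1 *: gradx f i x y)))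
       0 k,
   rho^-1 *: (y - Py Y g rho (y + rho *: grady f x y))).

End MinMax.

(* Main.v *)
Require Import Defs.
From HB Require Import structures.
From mathcomp Require Import all_boot all_order all_algebra.
From mathcomp Require Import all_classical all_reals all_analysis.
From mathcomp Require Import ring lra.

Set Implicit Arguments.
Unset Strict Implicit.
Unset Printing Implicit Defensive.

Import Order.TTheory GRing.Theory Num.Theory.
Import numFieldNormedType.Exports.

Local Open Scope classical_set_scope.
Local Open Scope ring_scope.

(** The theorem holds because a potential, bounded below, decreases at every
    iteration by a multiple of the squared step
    |x^{r+1} - x^r|^2 + |y^{r+1} - y^r|^2, while the squared stationarity gap
    at (x^{r+1}, y^{r+1}) is at most a multiple of the same quantity.  The
    squared gaps are therefore summable, so among the first n of them one is
    O(1/n), and the gap falls below eps within O(1/eps^2) iterations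
    ([gap_square_summable], [hitting_time_bigO]).

    Write b for |x^{r+2} - x^{r+1}|^2, a0 for |y^{r+1} - y^r|^2 and a1 for
    |y^{r+2} - y^{r+1}|^2.

    The x-update is a descent step: the variational inequality of block i, the
    strong convexity of U_i and the descent lemma for f make f + h_i drop by
    (beta + mu_i - L_{x_i}/2) times the squared step ([x_block_descent]).

    The y-update increases the objective, and this increase has to be paid
    for.  Comparing the variational inequalities of two consecutive y-steps
    ([y_two_steps]) gives a bound on the increase in terms of a0, a1, b, and
    also a contraction estimate: strong concavity forces a1 to be smaller than
    a0 up to a multiple of b.  Adding 4/(theta rho) times the second
    inequality to the first makes the coefficients of a0 and a1 add up to less
    than 0, at the price of
    L_y^2 (2/(theta^2 rho) + rho/2) b; this is exactly what the lower bound on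
    beta lets the x-descent absorb.  The potential is thus the objective plus a
    weighted a0 ([potential_y_descent], [potential_descent]).

    For the gap, the variational inequality of each update says that the new
    iterate is a proximal point for a slightly perturbed gradient, and the
    proximal residual is then at most the perturbation ([prox_residual_le]),
    which the Lipschitz bounds control by the steps ([gap_le]).  The proximal
    points in the gap exist because a finite convex function on a
    finite-dimensional space is continuous ([convex_continuous]). *)

(** * Euclidean inner product *)

Section EuclideanSpace.
Variable R : realType.

Lemma dotvC n (u v : 'rV[R]_n) : dotv u v = dotv v u.
Proof. by apply: eq_bigr => k _; rewrite mulrC. Qed.

Lemma dotvDl n (u v w : 'rV[R]_n) : dotv (u + v) w = dotv u w + dotv v w.
Proof. by rewrite -big_split; apply: eq_bigr => k _; rewrite !mxE mulrDl. Qed.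

Lemma dotvZl n a (u v : 'rV[R]_n) : dotv (a *: u) v = a * dotv u v.
Proof. by rewrite mulr_sumr; apply: eq_bigr => k _; rewrite !mxE mulrA. Qed.

Lemma dotvNl n (u v : 'rV[R]_n) : dotv (- u) v = - dotv u v.
Proof. by rewrite -scaleN1r dotvZl mulN1r. Qed.

Lemma dotvDr n (u v w : 'rV[R]_n) : dotv u (v + w) = dotv u v + dotv u w.
Proof. by rewrite !(dotvC u) dotvDl. Qed.

Lemma dotvZr n a (u v : 'rV[R]_n) : dotv u (a *: v) = a * dotv u v.
Proof. by rewrite !(dotvC u) dotvZl. Qed.

Lemma dotvNr n (u v : 'rV[R]_n) : dotv u (- v) = - dotv u v.
Proof. by rewrite !(dotvC u) dotvNl. Qed.

Definition dotvE := (dotvDl, dotvDr, dotvNl, dotvNr, dotvZl, dotvZr).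

Lemma enorm_ge0 m n (A : 'M[R]_(m, n)) : 0 <= enorm A.
Proof. exact: sqrtr_ge0. Qed.

Lemma sqr_enorm_rows m n (A : 'M[R]_(m, n)) :
  enorm A ^+ 2 = \sum_(i < m) enorm (row i A) ^+ 2.
Proof.
have sq_ge0 p q (B : 'M[R]_(p, q)) : 0 <= \sum_(i < p) \sum_(k < q) B i k ^+ 2.
  by apply: sumr_ge0 => i _; apply: sumr_ge0 => k _; exact: sqr_ge0.
rewrite /enorm sqr_sqrtr //; apply: eq_bigr => i _.
rewrite sqr_sqrtr // big_ord1; apply: eq_bigr => k _; by rewrite mxE.
Qed.

Lemma sqr_enorm n (u : 'rV[R]_n) : enorm u ^+ 2 = dotv u u.
Proof.
rewrite /enorm big_ord1 sqr_sqrtr; last first.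
  by apply: sumr_ge0 => k _; exact: sqr_ge0.
by apply: eq_bigr => k _; rewrite expr2.
Qed.

Lemma dotv_ge0 n (u : 'rV[R]_n) : 0 <= dotv u u.
Proof. by rewrite -sqr_enorm sqr_ge0. Qed.

Lemma enormN m n (A : 'M[R]_(m, n)) : enorm (- A) = enorm A.
Proof.
congr Num.sqrt; apply: eq_bigr => i _; apply: eq_bigr => k _.
by rewrite mxE sqrrN.
Qed.

Lemma sqr_pnorm m n p (z : 'M[R]_(m, n) * 'rV[R]_p) :
  pnorm z ^+ 2 = enorm z.1 ^+ 2 + enorm z.2 ^+ 2.
Proof. by rewrite /pnorm sqr_sqrtr // addr_ge0 ?sqr_ge0. Qed.

Lemma pnorm_ge0 m n p (z : 'M[R]_(m, n) * 'rV[R]_p) : 0 <= pnorm z.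
Proof. exact: sqrtr_ge0. Qed.

(** Expand |u - c v|^2 >= 0. *)
Lemma young n (c : R) (u v : 'rV[R]_n) : 0 < c ->
  dotv u v <= (2 * c)^-1 * enorm u ^+ 2 + c / 2 * enorm v ^+ 2.
Proof.
move=> c0; have := dotv_ge0 (u - c *: v).
rewrite !sqr_enorm !dotvE (dotvC v u) => sq_ge0.
rewrite -(ler_pM2l (_ : 0 < 2 * c)) ?mulr_gt0 //.
have -> : 2 * c * ((2 * c)^-1 * dotv u u + c / 2 * dotv v v)
          = dotv u u + c * (c * dotv v v) by field; exact: lt0r_neq0.
lra.
Qed.

(** For v <> 0, expand the square of <v,v> u - <u,v> v. *)
Lemma cauchy_schwarz n (u v : 'rV[R]_n) : dotv u v <= enorm u * enorm v.
Proof.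
suff sq : dotv u v ^+ 2 <= (enorm u * enorm v) ^+ 2.
  apply: le_trans (ler_norm _) _; rewrite -(@ler_pXn2r _ 2) //.
  - by rewrite real_normK // num_real.
  - by rewrite nnegrE mulr_ge0 ?enorm_ge0.
rewrite exprMn !sqr_enorm.
have [v0|v_neq0] := eqVneq (dotv v v) 0.
  have v_eq0 : v = 0.
    apply/rowP => k; rewrite mxE; apply/eqP; rewrite -sqrf_eq0 expr2; apply/eqP.
    by apply: (psumr_eq0P _ v0) => // i _; rewrite -expr2 sqr_ge0.
  by rewrite v_eq0 -(scale0r 0) !dotvZr !mul0r mulr0 expr0n.
have v_gt0 : 0 < dotv v v by rewrite lt_neqAle eq_sym v_neq0 dotv_ge0.
have := dotv_ge0 (dotv v v *: u - dotv u v *: v).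
rewrite !dotvE (dotvC v u) => gram.
by rewrite -subr_ge0 -(pmulr_rge0 _ v_gt0); lra.
Qed.

Lemma sqr_enormD_le n (u v : 'rV[R]_n) :
  enorm (u + v) ^+ 2 <= 2 * enorm u ^+ 2 + 2 * enorm v ^+ 2.
Proof.
by have := dotv_ge0 (u - v); rewrite !sqr_enorm !dotvE (dotvC v u); lra.
Qed.

Lemma sqr_lipschitz (L a b : R) : 0 <= a -> a <= L * b -> a ^+ 2 <= L ^+ 2 * b ^+ 2.
Proof. by move=> a0 ab; rewrite -exprMn lerXn2r // nnegrE // (le_trans a0). Qed.

Lemma enormZ m n (a : R) (A : 'M[R]_(m, n)) : enorm (a *: A) = `|a| * enorm A.
Proof.
rewrite /enorm -sqrtr_sqr -sqrtrM ?sqr_ge0 // mulr_sumr; congr Num.sqrt.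
apply: eq_bigr => i _; rewrite mulr_sumr; apply: eq_bigr => k _.
by rewrite mxE exprMn.
Qed.

Lemma enorm0 m n : enorm (0 : 'M[R]_(m, n)) = 0.
Proof. by rewrite -(scale0r 0) enormZ normr0 mul0r. Qed.

Lemma sqr_enorm_row_le m n (A : 'M[R]_(m, n)) (i : 'I_m) :
  enorm (row i A) ^+ 2 <= enorm A ^+ 2.
Proof.
rewrite [leRHS]sqr_enorm_rows (bigD1 i) //= lerDl.
by apply: sumr_ge0 => j _; exact: sqr_ge0.
Qed.

End EuclideanSpace.

(** * Convex minimisation and proximal points *)

Section Convexity.
Variable R : realType.

Lemma convex_segment (V : lmodType R) (S : set V) (x y : V) (t : R) :
  convex_set S -> S x -> S y -> 0 <= t <= 1 -> S (x + t *: (y - x)).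
Proof.
move=> cS Sx Sy /andP[t0 t1].
have t01 : Itv.spec (@Itv.num_sem R) (Itv.Real `[0%Z, 1%Z]) t.
  by rewrite /Itv.spec/= /Itv.num_sem/= num_real in_itv/= t0 t1.
have := cS y x (Itv.Def t01) (mem_set Sy) (mem_set Sx).
rewrite inE /conv/= scalerBl scale1r scalerBr.
by rewrite addrCA.
Qed.

Lemma convex_functionP (V : lmodType R) (h : V -> R) :
  convex_function setT h <-> forall (x y : V) (t : R), 0 <= t <= 1 ->
    h (t *: x + (1 - t) *: y) <= t * h x + (1 - t) * h y.
Proof.
split=> [ch x y t /andP[t0 t1]|ch t x y _ _]; last first.
  by apply: (ch x y t%:num); apply/andP; split.
have t01 : Itv.spec (@Itv.num_sem R) (Itv.Real `[0%Z, 1%Z]) t.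
  by rewrite /Itv.spec/= /Itv.num_sem/= num_real in_itv/= t0 t1.
exact: (ch (Itv.Def t01) x y (mem_set I) (mem_set I)).
Qed.

Lemma convex_function_segment (V : lmodType R) (h : V -> R) (x y : V) (t : R) :
  convex_function setT h -> 0 <= t <= 1 ->
  h (x + t *: (y - x)) <= h x + t * (h y - h x).
Proof.
move=> /convex_functionP ch t01; have := ch y x t t01.
rewrite scalerBl scale1r scalerBr addrCA; lra.
Qed.

(** First half of the continuity of convex functions: near x, a convex function
    grows at most linearly along combinations of finitely many directions.  By
    induction on their number: x + a + b is the midpoint of x + 2a and x + 2b,
    where a uses the first n directions and b the last one, and along a single
    direction e the slope is bounded by the increments of h at x + e, x - e. *)
Lemma convex_function_le_combination (V : lmodType R) (h : V -> R) (x : V) n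
    (e : 'I_n -> V) :
  convex_function setT h ->
  exists2 C, 0 <= C & exists2 d, 0 < d &
    forall (u : 'I_n -> R) (eps : R), eps <= d -> (forall k, `|u k| <= eps) ->
      h (x + \sum_(k < n) u k *: e k) - h x <= C * eps.
Proof.
move=> ch; elim: n e => [|n IHn] e.
  exists 0 => //; exists 1 => // u eps _ _.
  by rewrite big_ord0 addr0 subrr mul0r.
have [C C0 [d d0 Cd]] := IHn (fun k => e (widen_ord (leqnSn n) k)).
pose D := `|h (x + e ord_max) - h x| + `|h (x - e ord_max) - h x|.
exists (C + D); first by rewrite addr_ge0 // addr_ge0.
exists (Num.min (d / 2) 2^-1).
  by rewrite lt_min divr_gt0 // invr_gt0 ltr0n.
move=> u eps; rewrite le_min => /andP[eps_d eps_1] ueps.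
rewrite big_ord_recr /=; set a := \sum_(k < n) _; set b := _ *: _.
have eps0 : 0 <= eps by rewrite (le_trans _ (ueps ord_max)).
have ha : h (x + 2 *: a) - h x <= C * (2 * eps).
  rewrite /a scaler_sumr.
  have := Cd (fun k => 2 * u (widen_ord (leqnSn n) k)) (2 * eps).
  under eq_bigr do rewrite -scalerA.
  apply; first lra.
  by move=> k; rewrite normrM ger0_norm // ler_pM2l.
have hb : h (x + 2 *: b) - h x <= D * (2 * eps).
  have le_eps := ueps ord_max; rewrite /b scalerA.
  have [s0|s0] := leP 0 (u ord_max).
    have := @convex_function_segment _ h x (x + e ord_max) (2 * u ord_max) ch.
    rewrite addrAC subrr add0r; rewrite ger0_norm // in le_eps.
    have le1 : 0 <= 2 * u ord_max <= 1 by apply/andP; split; lra.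
    move=> /(_ le1) hle; have DD : h (x + e ord_max) - h x <= D.
      by rewrite (le_trans (ler_norm _)) // lerDl.
    have D0 : 0 <= D by exact: addr_ge0.
    nra.
  have := @convex_function_segment _ h x (x - e ord_max) (- (2 * u ord_max)) ch.
  rewrite addrAC subrr add0r scalerN scaleNr opprK; rewrite ltr0_norm // in le_eps.
  have le1 : 0 <= - (2 * u ord_max) <= 1 by apply/andP; split; lra.
  move=> /(_ le1) hle; have DD : h (x - e ord_max) - h x <= D.
    by rewrite (le_trans (ler_norm _)) // lerDr.
  have D0 : 0 <= D by exact: addr_ge0.
  nra.
have half : 0 <= (2^-1 : R) <= 1 by apply/andP; split; lra.
have := @convex_function_segment _ h (x + 2 *: a) (x + 2 *: b) 2^-1 ch half.
have -> : x + 2 *: a + 2^-1 *: (x + 2 *: b - (x + 2 *: a)) = x + (a + b).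
  rewrite opprD addrACA subrr add0r -scalerBr scalerA mulVf ?pnatr_eq0 //.
  by rewrite scale1r (scaler_nat 2 a) mulr2n -addrA addrACA subrr addr0.
lra.
Qed.

(** The upper bound of the previous lemma, applied to u and to -u, is turned into
    a two-sided one because x is the midpoint of x + u and x - u. *)
Lemma convex_continuous n (h : 'rV[R]_n -> R) :
  convex_function setT h -> continuous h.
Proof.
move=> ch x.
have [C C0 [d d0 Cd]] :=
  @convex_function_le_combination _ h x _ (fun k : 'I_n => delta_mx 0 k) ch.
have le_up u : `|u| <= d -> h (x + u) - h x <= C * `|u|.
  move=> ud; have := Cd (u 0) `|u| ud; rewrite -row_sum_delta; apply => k.
  rewrite [X in _ <= X](mx_normrE u).
  exact: (le_bigmax _ (fun i : 'I_1 * 'I_n => `|u i.1 i.2|) (0, k)).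
have le_abs u : `|u| <= d -> `|h x - h (x + u)| <= C * `|u|.
  move=> ud; have up := le_up u ud.
  have := le_up (- u); rewrite normrN => /(_ ud) dn.
  have half : 0 <= (2^-1 : R) <= 1 by apply/andP; split; lra.
  have := @convex_function_segment _ h (x + u) (x - u) 2^-1 ch half.
  have -> : x + u + 2^-1 *: (x - u - (x + u)) = x.
    by rewrite opprD addrACA subrr add0r -opprD scalerN -mulr2n -[u *+ 2]scaler_nat
               scalerA mulVf ?pnatr_eq0 // scale1r addrK.
  rewrite ler_norml; lra.
apply/(@cvgrPdist_le _ _ _ (nbhs x) (nbhs_filter x)) => eps eps0.
have ydist c : 0 < c -> \forall y \near x, `|y - x| <= c.
  move=> c0; near do rewrite distrC; exact: cvgr_dist_le.
have C1 : 0 < C + 1 by rewrite ltr_wpDl.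
near=> y.
have -> : y = x + (y - x) by rewrite addrC subrK.
apply: le_trans (le_abs _ _) _.
  by near: y; exact: ydist.
apply: (@le_trans _ _ ((C + 1) * `|y - x|)).
  by rewrite ler_wpM2r // lerDl.
by rewrite mulrC -ler_pdivlMr //; near: y; exact: (ydist _ (divr_gt0 eps0 C1)).
Unshelve. all: by end_near.
Qed.

Lemma convex_prox_objective n (h : 'rV[R]_n -> R) (c : R) (v : 'rV[R]_n) :
  convex_function setT h -> 0 <= c ->
  convex_function setT (fun z => h z + c / 2 * enorm (z - v) ^+ 2).
Proof.
move=> /convex_functionP ch c0; apply/convex_functionP => x y t t01.
have hle := ch x y t t01; case/andP: t01 => t0 t1.
have gap_ge0 : 0 <= c / 2 * (t * (1 - t) * dotv (x - y) (x - y)).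
  by rewrite !mulr_ge0 ?dotv_ge0 ?subr_ge0.
have -> : enorm (t *: x + (1 - t) *: y - v) ^+ 2
    = t * enorm (x - v) ^+ 2 + (1 - t) * enorm (y - v) ^+ 2
      - t * (1 - t) * dotv (x - y) (x - y).
  rewrite !sqr_enorm !dotvE (dotvC y x) (dotvC v x) (dotvC v y); ring.
lra.
Qed.

Lemma argmin_compact_exists n (S : set 'rV[R]_n) (F : 'rV[R]_n -> R) :
  S !=set0 -> compact S -> convex_function setT F -> argmin S F (get (argmin S F)).
Proof.
move=> S0 cS cF; apply: xgetPex.
have cont : {within S, continuous F}.
  exact: continuous_subspaceT (convex_continuous cF).
have [c cin cmin] := compact_EVT_min S0 cS cont.
by exists c; split; [exact: set_mem|move=> b Sb; apply: cmin; exact: mem_set].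
Qed.

(** Replaces taking the derivative at t = 0 in optimality conditions. *)
Lemma ge0_of_small_perturbation (A B : R) :
  (forall t, 0 < t <= 1 -> 0 <= t * A + t ^+ 2 * B) -> 0 <= A.
Proof.
move=> H; rewrite leNgt; apply/negP => A0.
have B1 : 0 < `|B| + 1 by rewrite ltr_wpDl.
pose t := Num.min 1 (- A / (2 * (`|B| + 1))).
have t0 : 0 < t by rewrite lt_min ltr01 divr_gt0 ?mulr_gt0 // oppr_gt0.
have t1 : t <= 1 by rewrite ge_min lexx.
have tA : t * (2 * (`|B| + 1)) <= - A.
  by rewrite -ler_pdivlMr ?mulr_gt0 // ge_min lexx orbT.
have := H t; rewrite t0 t1 => /(_ isT).
rewrite expr2 -mulrA -mulrDr pmulr_rge0 // => AB.
have : t * B <= t * `|B| by rewrite ler_pM2l // ler_norm.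
nra.
Qed.

(** First-order optimality at a minimiser m, in the direction of z: the convex h
    contributes at most h z - h m to the slope of the objective.  The slope of
    phi is given by an upper expansion to second order, which quadratics have
    as an equality and which strong convexity and a Lipschitz gradient provide
    for the surrogates U_i. *)
Lemma argmin_variational n (S : set 'rV[R]_n) (phi h : 'rV[R]_n -> R)
    (m z : 'rV[R]_n) (A B : R) :
  convex_set S -> convex_function setT h ->
  argmin S (fun w => phi w + h w) m -> S z ->
  (forall t, 0 <= t <= 1 ->
     phi (m + t *: (z - m)) - phi m <= t * A + t ^+ 2 * B) ->
  h m - h z <= A.
Proof.
move=> cS ch [Sm mmin] Sz phi_le.
suff : 0 <= A + (h z - h m) by lra.
apply: (@ge0_of_small_perturbation _ B) => t /andP[t0 t1].
have t01 : 0 <= t <= 1 by rewrite ltW.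
have := mmin _ (convex_segment cS Sm Sz t01).
have := phi_le t t01.
have := convex_function_segment m z ch t01.
lra.
Qed.

Lemma prox_variational n (S : set 'rV[R]_n) (h : 'rV[R]_n -> R) (c : R)
    (v m z : 'rV[R]_n) :
  convex_set S -> convex_function setT h ->
  argmin S (fun w => h w + c / 2 * enorm (w - v) ^+ 2) m -> S z ->
  h m - h z <= c * dotv (m - v) (z - m).
Proof.
move=> cS ch mmin Sz.
apply: (argmin_variational (phi := fun w => c / 2 * enorm (w - v) ^+ 2)
          (B := c / 2 * enorm (z - m) ^+ 2)) cS ch _ Sz _.
  case: mmin => Sm mmin; split=> // w Sw; rewrite addrC [leRHS]addrC; exact: mmin.
move=> t _; rewrite le_eqVlt; apply/orP; left; apply/eqP.
rewrite !sqr_enorm !dotvE (dotvC v m) (dotvC z m) (dotvC z v); by field.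
Qed.

(** Nonexpansiveness of the proximal map in residual form.  The hypothesis on q
    says that p is the proximal point of p - q/c; replacing q by w moves the
    proximal point by at most |q - w|/c.  Adding the variational inequality of
    the proximal point, tested at p, to the hypothesis, tested at the proximal
    point, gives c |p' - p|^2 <= <q - w, p' - p>. *)
Lemma prox_residual_le n (S : set 'rV[R]_n) (h : 'rV[R]_n -> R) (c : R)
    (p q w : 'rV[R]_n) :
  convex_set S -> compact S -> convex_function setT h -> 0 < c -> S p ->
  (forall z, S z -> h p - h z <= dotv q (z - p)) ->
  enorm (c *: (p - get (argmin S
     (fun z => h z + c / 2 * enorm (z - (p - c^-1 *: w)) ^+ 2)))) ^+ 2
  <= enorm (q - w) ^+ 2.
Proof.
move=> cS kS ch c0 Sp pq; set m := get _.
have mmin : argmin S (fun z => h z + c / 2 * enorm (z - (p - c^-1 *: w)) ^+ 2) m.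
  apply: argmin_compact_exists => //; first by exists p.
  exact: convex_prox_objective (ltW c0).
have vi := prox_variational cS ch mmin Sp.
have vp := pq _ mmin.1.
have yg := young (q - w) (m - p) c0.
have c20 : 0 < (2 * c)^-1 by rewrite invr_gt0 mulr_gt0.
rewrite -(ler_pM2l c20).
have -> : (2 * c)^-1 * enorm (c *: (p - m)) ^+ 2 = c / 2 * enorm (p - m) ^+ 2.
  rewrite !sqr_enorm dotvZl dotvZr; field; exact: lt0r_neq0.
move: vi vp yg.
have -> : c * dotv (m - (p - c^-1 *: w)) (p - m)
          = c * dotv (m - p) (p - m) + dotv w (p - m).
  by rewrite !dotvE; field; exact: lt0r_neq0.
rewrite !sqr_enorm !dotvE (dotvC m p); lra.
Qed.

End Convexity.

(** * Block updates of a matrix *)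

Section Blocks.
Variables (R : realType) (K N : nat).

Lemma setblock_row (x : 'M[R]_(K, N)) (i : 'I_K) : setblock x i (row i x) = x.
Proof. by apply/matrixP => j k; rewrite !mxE; case: eqP => // ->. Qed.

Lemma setblockD (x : 'M[R]_(K, N)) (i : 'I_K) v :
  setblock x i (row i x + v) = x + setblock 0 i v.
Proof.
by apply/matrixP => j k; rewrite !mxE; case: eqP => [->|]; rewrite ?addr0.
Qed.

Lemma setblock_sum (i : 'I_K) (v : 'rV[R]_N) :
  setblock 0 i v = \sum_(k < N) v 0 k *: delta_mx i k.
Proof.
apply/matrixP => j l; rewrite mxE summxE (bigD1 l) //= big1 => [|k k_l].
  by rewrite !mxE eqxx andbT addr0; case: eqP; rewrite ?mulr1 ?mulr0 // mxE.
by rewrite !mxE (eq_sym l) (negbTE k_l) andbF mulr0.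
Qed.

Lemma enorm_setblock0 (i : 'I_K) (v : 'rV[R]_N) :
  enorm (setblock 0 i v) = enorm v.
Proof.
apply/eqP; rewrite -(@eqrXn2 _ 2) ?enorm_ge0 //
  (sqr_enorm_rows (setblock 0 i v)) (bigD1 i) //=.
rewrite big1 ?addr0 => [|j ji].
  by apply/eqP; congr (enorm _ ^+ 2); apply/rowP => k; rewrite !mxE eqxx.
have -> : row j (setblock 0 i v) = 0.
  by apply/rowP => k; rewrite !mxE (negbTE ji).
by rewrite enorm0 expr0n.
Qed.

(** [mixblock] with an arbitrary natural number as its index, so that the sweep
    over the blocks runs from x (index 0) to x' (index K) and telescopes. *)
Definition mixed (x' x : 'M[R]_(K, N)) (k : nat) : 'M[R]_(K, N) :=
  \matrix_(j, l) (if (j < k)%N then x' j l else x j l).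

Lemma mixed0 (x' x : 'M[R]_(K, N)) : mixed x' x 0 = x.
Proof. by apply/matrixP => j l; rewrite mxE. Qed.

Lemma mixedK (x' x : 'M[R]_(K, N)) : mixed x' x K = x'.
Proof. by apply/matrixP => j l; rewrite mxE ltn_ord. Qed.

Lemma mixedS (x' x : 'M[R]_(K, N)) (i : 'I_K) :
  mixed x' x i.+1 = mixed x' x i + setblock 0 i (row i x' - row i x).
Proof.
apply/matrixP => j l; rewrite !mxE ltnS leq_eqVlt -val_eqE.
case: (ltngtP j i) => [||/val_inj ->] /=; rewrite ?addr0 ?ltnn //.
by rewrite addrC subrK.
Qed.

Lemma row_mixed (x' x : 'M[R]_(K, N)) (i : 'I_K) : row i (mixed x' x i) = row i x.
Proof. by apply/rowP => k; rewrite !mxE ltnn. Qed.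

Lemma enorm_mixedB_le (x' x : 'M[R]_(K, N)) k :
  enorm (mixed x' x k - x') ^+ 2 <= enorm (x' - x) ^+ 2.
Proof.
rewrite !sqr_enorm_rows; apply: ler_sum => j _.
have [jk|jk] := boolP (j < k)%N.
  have -> : row j (mixed x' x k - x') = 0.
    by apply/rowP => l; rewrite !mxE jk subrr.
  by rewrite enorm0 expr0n sqr_ge0.
have -> : row j (mixed x' x k - x') = - row j (x' - x).
  by apply/rowP => l; rewrite !mxE (negbTE jk) opprB.
by rewrite enormN.
Qed.

End Blocks.

(** * Derivatives along a segment *)

Section Calculus.
Variable R : realType.

(** The two difference quotients coincide, because F (p + (s + t) d) is
    F (s d + (p + t d)). *)
Lemma is_derive_line (V : normedModType R) (F : V -> R) (p d : V) (t : R) :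
  differentiable F (p + t *: d) ->
  is_derive t 1 (fun s : R => F (p + s *: d)) ('D_d F (p + t *: d)).
Proof.
move=> dF; have quotE : (fun s : R => s^-1 *: (((fun s : R => F (p + s *: d)) \o
    shift t) (s *: 1) - F (p + t *: d)))
  = (fun s : R => s^-1 *: ((F \o shift (p + t *: d)) (s *: d) - F (p + t *: d))).
  apply/funext => s /=; congr (_ *: (F _ - _)).
  by rewrite scalerDl [_ *: 1]mulr1 addrCA addrA.
apply: DeriveDef.
  by rewrite /derivable quotE; exact: diff_derivable.
by rewrite /derive quotE.
Qed.

(** C plays the role of L |d|^2.  The mean value theorem is applied to
    F (p + t d) - t D_d F(p) - t^2 C/2, whose derivative is nonpositive. *)
Lemma descent_lemma (V : normedModType R) (F : V -> R) (p d : V) (C : R) :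
  (forall z, differentiable F z) ->
  (forall t, 0 <= t <= 1 -> 'D_d F (p + t *: d) - 'D_d F p <= t * C) ->
  F (p + d) - F p <= 'D_d F p + C / 2.
Proof.
move=> dF dF_le.
pose G := fun t : R => F (p + t *: d).
pose Q := fun t : R => 'D_d F p * t + C / 2 * t ^+ 2.
have dG (t : R) : is_derive t (1 : R) G ('D_d F (p + t *: d)).
  exact: is_derive_line.
have dQ (t : R) : is_derive t (1 : R) Q ('D_d F p + C * t).
  have dX : is_derive t (1 : R) (id ^+ 2 : R -> R) _ := is_deriveX 2 (is_derive_id t 1).
  have dZ1 := is_deriveZ ('D_d F p) (is_derive_id t (1 : R)).
  have dZ2 := is_deriveZ (C / 2) dX.
  apply: (is_derive_eq (is_deriveD dZ1 dZ2)).
  rewrite /GRing.scale /=; by field.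
have dGQ (t : R) : is_derive t (1 : R) (G \- Q)
    ('D_d F (p + t *: d) - ('D_d F p + C * t)).
  exact: is_deriveB.
have cGQ : {within `[0, 1], continuous (G \- Q)}.
  apply: derivable_within_continuous => t _; exact: (@ex_derive _ _ _ _ _ _ _ (dGQ t)).
have [c c01] := MVT_segment (@ler01 R) (fun t _ => dGQ t) cGQ.
rewrite in_itv /= in c01; have := dF_le c c01.
rewrite /G /Q /= scale0r scale1r addr0; lra.
Qed.

(** The block gradient represents the differential of f in the directions of
    block i. *)
Lemma dotv_gradx K N M (f : 'M[R]_(K, N) * 'rV[R]_M -> R) (i : 'I_K) x y v :
  differentiable f (x, y) ->
  dotv (gradx f i x y) v = 'D_((setblock 0 i v, 0)) f (x, y).
Proof.
move=> df; rewrite deriveE // setblock_sum.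
have gradxE k : (gradx f i x y) 0 k = 'd f (x, y) (delta_mx i k, 0).
  rewrite mxE -deriveE // /derive.
  have -> : (fun s : R => s^-1 *: (((fun z => f (setblock x i z, y)) \o
        shift (row i x)) (s *: delta_mx 0 k) - f (setblock x i (row i x), y)))
    = (fun s : R => s^-1 *: ((f \o shift (x, y)) (s *: (delta_mx i k, 0))
        - f (x, y))) => //.
  apply/funext => s /=; rewrite setblock_row (addrC _ (row i x)) setblockD.
  congr (_ *: (f (_, _) - _)); last by rewrite /= scaler0 add0r.
  rewrite /= [RHS]addrC; congr (_ + _); apply/matrixP => j l; rewrite !mxE /=.
  by case: eqP => //; rewrite mulr0.
have -> : (\sum_(k < N) v 0 k *: delta_mx i k, 0)
    = \sum_(k < N) v 0 k *: (delta_mx i k, 0) :> 'M[R]_(K, N) * 'rV[R]_M.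
  apply: (big_ind2 (fun w z => (w, 0) = z :> _ * _)) => // [w _ w' _ <- <-|k _].
    by congr pair; rewrite addr0.
  by congr pair; rewrite scaler0.
rewrite linear_sum; apply: eq_bigr => k _.
by rewrite linearZ gradxE mulrC.
Qed.

End Calculus.

(** * Descent in the blocks of x *)

Section Iteration.
Variables (R : realType) (K N M : nat).
Variables (X : 'I_K -> set 'rV[R]_N) (Y : set 'rV[R]_M).
Variables (f : 'M[R]_(K, N) * 'rV[R]_M -> R).
Variables (h : 'I_K -> 'rV[R]_N -> R) (g : 'rV[R]_M -> R).
Variables (Lx : 'I_K -> R) (Ly : R).
Variable U : 'I_K -> 'rV[R]_N -> 'M[R]_(K, N) -> 'rV[R]_M -> R.
Variables (mu Lu : 'I_K -> R) (theta rho beta : R).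
Variables (xs : nat -> 'M[R]_(K, N)) (ys : nat -> 'rV[R]_M).
Hypothesis HA : assumptionA X Y f h g Lx Ly.
Hypothesis HB : assumptionB X Y f U mu Lu.
Hypothesis HC : assumptionC1 X Y f theta rho.
Hypothesis Halg :
  HiBSA X Y h g U (Uy_C1 f rho) (fun=> beta) (fun=> 0) xs ys.

Lemma mixed_prodset (x' x : 'M[R]_(K, N)) k :
  prodset X x' -> prodset X x -> prodset X (mixed x' x k).
Proof.
move=> Xx' Xx j.
have [jk|jk] := boolP (j < k)%N.
  have -> : row j (mixed x' x k) = row j x'; last exact: Xx'.
  by apply/rowP => l; rewrite !mxE jk.
have -> : row j (mixed x' x k) = row j x; last exact: Xx.
by apply/rowP => l; rewrite !mxE (negbTE jk).
Qed.

Lemma convexX i : convex_set (X i).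
Proof. by case: HA. Qed.

Lemma convexh i : convex_function setT (h i).
Proof. by case: HA. Qed.

Lemma iterX r : (1 <= r)%N -> prodset X (xs r).
Proof.
case: r => [//|[_|r _ i]]; first exact: HiBSA_startx Halg.
by case: (HiBSA_x Halg (isT : (1 <= r.+1)%N) i).
Qed.

Lemma iterY r : (1 <= r)%N -> Y (ys r).
Proof.
case: r => [//|[_|r _]]; first exact: HiBSA_starty Halg.
by case: (HiBSA_y Halg (isT : (1 <= r.+1)%N)).
Qed.

Local Notation wmix r i := (mixed (xs r.+1) (xs r) i).
Local Notation gradU i r := (fun z => grad (fun v => U i v (wmix r i) (ys r)) z).

Lemma wmix_prodset r k : (1 <= r)%N -> prodset X (wmix r k).
Proof. by move=> r1; apply: mixed_prodset; exact: iterX. Qed.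

(** The expansion required by [argmin_variational] comes from strong convexity
    read at the moving point m + t d, with the Lipschitz continuity of the
    gradient of U_i bringing the gradient back to m. *)
Lemma x_variational r (i : 'I_K) z : (1 <= r)%N -> X i z ->
  h i (row i (xs r.+1)) - h i z
  <= dotv (gradU i r (row i (xs r.+1)) + beta *: (row i (xs r.+1) - row i (xs r)))
       (z - row i (xs r.+1)).
Proof.
move=> r1 Xz; have [] := HiBSA_x Halg r1 i.
rewrite -[mixblock _ _ _]/(wmix r i).
set p := row i (xs r); set m := row i (xs r.+1) => Xm mmin.
have Xw := wmix_prodset i r1; have Yy := iterY r1.
(* A name without a body: otherwise [dotvE] would expand the difference. *)
have [d dE] : {d | d = z - m} by exists (z - m).
rewrite -dE.
apply: (argmin_variational (S := X i) (h := h i) (m := m) (z := z)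
  (phi := fun v => U i v (wmix r i) (ys r) + beta / 2 * enorm (v - p) ^+ 2)
  (B := Lu i * enorm d ^+ 2 + beta / 2 * enorm d ^+ 2)) => //.
- exact: convexX.
- exact: convexh.
- split=> // v Xv; have := mmin v Xv.
  by rewrite -!addrA ![h i _ + _]addrC.
move=> t t01; have Xmt := convex_segment (@convexX i) Xm Xz t01.
case/andP: t01 => t0 t1.
rewrite -dE in Xmt; rewrite -dE.
have := B1 HB Xw Yy Xm Xmt; have := B4 HB Xw Yy Xm Xmt.
set mt := m + t *: d; set G := grad _.
have -> : m - mt = - (t *: d) by rewrite /mt opprD addrA subrr add0r.
rewrite !enormN enormZ ger0_norm // => lipU strongU.
have mu0 : 0 <= mu i / 2 * (t * enorm d) ^+ 2.
  by rewrite mulr_ge0 ?sqr_ge0 // divr_ge0 // ltW // (B1_mu HB).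
have csU : dotv (G mt - G m) d <= Lu i * (t * enorm d) * enorm d.
  apply: le_trans (cauchy_schwarz _ _) _.
  by rewrite ler_wpM2r // enorm_ge0.
have quad : enorm (mt - p) ^+ 2
    = enorm (m - p) ^+ 2 + 2 * t * dotv (m - p) d + t ^+ 2 * enorm d ^+ 2.
  rewrite !sqr_enorm /mt !dotvE (dotvC d m) (dotvC p m) (dotvC d p); ring.
rewrite quad; move: strongU csU; rewrite !dotvE => strongU csU.
have := ler_wpM2l t0 csU; lra.
Qed.

(** The descent lemma bounds the change of f by its linear part plus
    L_{x_i}/2 |d|^2; the linear part is <grad U_i(old), d> by the gradient
    consistency of U_i.  Strong convexity replaces the old gradient by the new
    one at a gain of mu_i |d|^2, and the optimality of the new block trades
    <grad U_i(new), d> for the change of h_i at a gain of beta |d|^2. *)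
Lemma x_block_descent r (i : 'I_K) : (1 <= r)%N ->
  f (wmix r i.+1, ys r) + h i (row i (xs r.+1))
  <= f (wmix r i, ys r) + h i (row i (xs r))
     - (beta + mu i - Lx i / 2) * enorm (row i (xs r.+1 - xs r)) ^+ 2.
Proof.
move=> r1; set y0 := ys r; set w := wmix r i.
have Xw := wmix_prodset i r1; have Yy := iterY r1.
have Xp := iterX r1 i; have Xm := @iterX r.+1 isT i.
have := x_variational r1 Xp.
set p := row i (xs r); set m := row i (xs r.+1); set G := grad _ => vi.
have [d dE] : {d | d = m - p} by exists (m - p).
have -> : row i (xs r.+1 - xs r) = d by rewrite raddfB.
rewrite mixedS -/w -/m -/p -dE.
pose V : 'M[R]_(K, N) * 'rV[R]_M := (setblock 0 i d, 0).
have lineE t : (w, y0) + t *: V = (w + setblock 0 i (t *: d), y0).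
  congr pair; last by rewrite /= scaler0 addr0.
  congr (_ + _); apply/matrixP => j l; rewrite !mxE.
  by case: eqP => //; rewrite mulr0.
have Xline t : 0 <= t <= 1 -> prodset X (w + setblock 0 i (t *: d)).
  move=> t01 j; have [->|ji] := eqVneq j i.
    have -> : row i (w + setblock 0 i (t *: d)) = p + t *: d; last first.
      rewrite dE; exact: (convex_segment (@convexX i)).
    rewrite raddfD /= row_mixed; congr (_ + _).
    by apply/rowP => l; rewrite !mxE eqxx.
  have -> : row j (w + setblock 0 i (t *: d)) = row j w; last exact: Xw.
  by apply/rowP => l; rewrite !mxE (negbTE ji) addr0.
have fdiff := A1_diff HA.
have gradE t : 'D_V f ((w, y0) + t *: V)
    = dotv (gradx f i (w + setblock 0 i (t *: d)) y0) d.
  by rewrite lineE dotv_gradx.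
have grad0E : 'D_V f (w, y0) = dotv (gradx f i w y0) d by rewrite dotv_gradx.
have lip t : 0 <= t <= 1 ->
    'D_V f ((w, y0) + t *: V) - 'D_V f (w, y0) <= t * (Lx i * enorm d ^+ 2).
  move=> t01; rewrite gradE grad0E -dotvNl -dotvDl.
  apply: le_trans (cauchy_schwarz _ _) _.
  have := A3_x HA Xw (Xline t t01) Yy Yy i.
  have -> : pnorm ((w + setblock 0 i (t *: d), y0) - (w, y0)) = t * enorm d.
    rewrite /pnorm /= subrr enorm0 addrAC subrr add0r enorm_setblock0 enormZ.
    case/andP: t01 => t0 _.
    by rewrite expr0n addr0 sqrtr_sqr !ger0_norm // ?mulr_ge0 ?enorm_ge0.
  move=> le; apply: le_trans (ler_wpM2r (enorm_ge0 d) le) _.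
  by rewrite le_eqVlt; apply/orP; left; apply/eqP; ring.
have := descent_lemma fdiff lip.
have := lineE 1; rewrite !scale1r => ->; rewrite grad0E.
have := B2 HB i Xw Yy; rewrite row_mixed -/p -/w -/y0 => B2w.
have := B1 HB Xw Yy Xm Xp; have := B1 HB Xw Yy Xp Xm.
rewrite -/w -/y0 -/G -/m -/p.
move: vi; rewrite -B2w -/G.
have -> : p - m = - d by rewrite dE opprB.
rewrite -dE enormN !sqr_enorm.
rewrite !(dotvDl, dotvNr, dotvZl); lra.
Qed.

Local Notation ell x y := (objective f h g x y).

Lemma x_descent r : (1 <= r)%N ->
  ell (xs r.+1) (ys r) <= ell (xs r) (ys r)
    - \sum_(i < K) (beta + mu i - Lx i / 2)
                   * enorm (row i (xs r.+1 - xs r)) ^+ 2.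
Proof.
move=> r1; pose F k := f (wmix r k, ys r).
have telF : f (xs r.+1, ys r) - f (xs r, ys r) = \sum_(i < K) (F i.+1 - F i).
  by rewrite -(big_mkord predT (fun i => F i.+1 - F i)) telescope_sumr // /F
             mixedK mixed0.
have : \sum_(i < K) (F i.+1 - F i) <= \sum_(i < K) (h i (row i (xs r))
     - h i (row i (xs r.+1)) - (beta + mu i - Lx i / 2)
        * enorm (row i (xs r.+1 - xs r)) ^+ 2).
  by apply: ler_sum => i _; have := x_block_descent i r1; rewrite /F; lra.
rewrite -telF !sumrB /objective; lra.
Qed.

(** * One step of gradient ascent in y *)

Lemma convexY : convex_set Y.
Proof. by case: HA. Qed.

Lemma convexg : convex_function setT g.
Proof. by case: HA. Qed.

Let rho_gt0 : 0 < rho := C1_rho HC.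
Let theta_gt0 : 0 < theta := lt_trans ltr01 (C1_theta HC).

(** The y-update is a proximal gradient step, since - Uy is a quadratic with
    slope (y^{r+1} - y^r)/rho - grad_y f at y^{r+1}. *)
Lemma y_variational r v : (1 <= r)%N -> Y v ->
  g (ys r.+1) - g v
  <= dotv (rho^-1 *: (ys r.+1 - ys r) - grady f (xs r.+1) (ys r))
       (v - ys r.+1).
Proof.
move=> r1 Yv; have [Ym mmax] := HiBSA_y Halg r1.
set p := ys r in mmax *; set m := ys r.+1 in Ym mmax *.
set F := grady f (xs r.+1) p.
have [d dE] : {d | d = v - m} by exists (v - m).
apply: (argmin_variational (S := Y) (h := g) (m := m) (z := v)
  (phi := fun u => - Uy_C1 f rho u (xs r.+1) p)
  (B := (2 * rho)^-1 * enorm d ^+ 2)) => //.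
- exact: convexY.
- exact: convexg.
- by split=> // u Yu; have := mmax u Yu; rewrite !mul0r !subr0; lra.
move=> t _; rewrite -dE /Uy_C1 -/F le_eqVlt; apply/orP; left; apply/eqP.
rewrite !sqr_enorm !dotvE !(dotvC d m) !(dotvC p m) !(dotvC d p); field.
exact: lt0r_neq0.
Qed.

Lemma grady_sqr_lipschitz x x' y y' :
  prodset X x -> prodset X x' -> Y y -> Y y' ->
  enorm (grady f x' y' - grady f x y) ^+ 2
  <= Ly ^+ 2 * (enorm (x' - x) ^+ 2 + enorm (y' - y) ^+ 2).
Proof.
move=> Xx Xx' Yy Yy'.
have := A3_y HA Xx Xx' Yy Yy'.
by move=> /(sqr_lipschitz (enorm_ge0 _)); rewrite sqr_pnorm.
Qed.

(** Add the strong concavity inequalities for (y, y') and (y', y). *)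
Lemma grady_monotone x y y' : prodset X x -> Y y -> Y y' ->
  dotv (grady f x y' - grady f x y) (y' - y)
  <= - theta * enorm (y' - y) ^+ 2.
Proof.
move=> Xx Yy Yy'.
have := C1_concave HC Xx Yy Yy'; have := C1_concave HC Xx Yy' Yy.
by rewrite !sqr_enorm !dotvE !(dotvC y y'); lra.
Qed.

(** Strong concavity and the Lipschitz bound give theta |d|^2 <= <- G, d> with
    |G| <= L_y |d|, and Young's inequality concludes.  Hence the potential is at
    least the objective, whatever the sign of its weight. *)
Lemma y_curvature_ge0 x y y' : prodset X x -> Y y -> Y y' ->
  0 <= (rho^-1 / 2 - theta + rho * Ly ^+ 2 / 2) * enorm (y' - y) ^+ 2.
Proof.
move=> Xx Yy Yy'.
have mono := grady_monotone Xx Yy Yy'.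
have := grady_sqr_lipschitz Xx Xx Yy Yy'.
rewrite subrr enorm0 expr0n add0r => lip.
have rhoV : 0 < rho^-1 by rewrite invr_gt0.
have := young (- (grady f x y' - grady f x y)) (y' - y) rhoV.
rewrite enormN dotvNl invfM invrK => yg.
have := ler_wpM2l (ltW rho_gt0) lip; lra.
Qed.

(** Let d0, d1 be two consecutive y-steps.  Testing the optimality of y^{r+1} at
    y^{r+2}, and of y^{r+2} at y^{r+1}, compares the gradients F0, F1 used in
    the two steps.  Their difference splits as G + H: G is the change due to
    d0, with <G, d0> <= - theta |d0|^2, and H the change due to the x-step.  Writing
    <G, d1> = <G, d0> + <G, d1 - d0>, Young's inequality bounds the last term
    by rho/2 |G|^2 plus a multiple of |d1 - d0|^2 that cancels against the
    same square in <d0, d1>/rho.  For the first conclusion, which bounds the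
    increase of the objective, <H, d1> is split with weight 1/rho; for the
    second, the contraction of the y-steps, with weight theta. *)
Lemma y_two_steps r : (1 <= r)%N ->
  let a0 := enorm (ys r.+1 - ys r) ^+ 2 in
  let a1 := enorm (ys r.+2 - ys r.+1) ^+ 2 in
  let b := enorm (xs r.+2 - xs r.+1) ^+ 2 in
  ell (xs r.+2) (ys r.+2) <= ell (xs r.+2) (ys r.+1)
    + (rho^-1 - theta / 2) * a1
    + (rho^-1 / 2 - theta + rho * Ly ^+ 2 / 2) * a0 + rho * Ly ^+ 2 / 2 * b
  /\ (rho^-1 / 2 - theta / 2) * a1
     <= (rho^-1 / 2 - theta + rho * Ly ^+ 2 / 2) * a0
        + Ly ^+ 2 / (2 * theta) * b.
Proof.
move=> r1; set y0 := ys r; set y1 := ys r.+1; set y2 := ys r.+2.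
set x1 := xs r.+1; set x2 := xs r.+2 => a0 a1 b.
have Xx1 : prodset X x1 := @iterX r.+1 isT.
have Xx2 : prodset X x2 := @iterX r.+2 isT.
have Yy0 : Y y0 := iterY r1.
have Yy1 : Y y1 := @iterY r.+1 isT.
have Yy2 : Y y2 := @iterY r.+2 isT.
have vi0 := y_variational r1 Yy2.
have vi1 := @y_variational r.+1 _ isT Yy1.
rewrite -/y0 -/y1 -/y2 -/x1 -/x2 in vi0 vi1.
have conc := C1_concave HC Xx2 Yy1 Yy2.
have mono := grady_monotone Xx1 Yy0 Yy1.
have lipG := grady_sqr_lipschitz Xx1 Xx1 Yy0 Yy1.
have lipH := grady_sqr_lipschitz Xx1 Xx2 Yy1 Yy1.
rewrite subrr enorm0 expr0n add0r -/a0 in lipG.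
rewrite subrr enorm0 expr0n addr0 -/b in lipH.
set F0 := grady f x1 y0 in vi0 mono lipG; set Fm := grady f x1 y1 in mono lipG lipH.
set F1 := grady f x2 y1 in vi1 conc lipH.
(* Names without a body: otherwise [dotvE] would expand the differences. *)
have [d0 d0E] : {d | d = y1 - y0} by exists (y1 - y0).
have [d1 d1E] : {d | d = y2 - y1} by exists (y2 - y1).
have [G GE] : {G | G = Fm - F0} by exists (Fm - F0).
have [H HE] : {H | H = F1 - Fm} by exists (F1 - Fm).
have F1E : F1 = F0 + G + H by rewrite GE HE (addrC F0) subrK addrC subrK.
have y12 : y1 - y2 = - d1 by rewrite d1E opprB.
rewrite y12 -?d0E -?d1E -?GE -?HE F1E in vi0 vi1 conc mono lipG lipH.
have rhoV : 0 < rho^-1 by rewrite invr_gt0.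
have ygG := young G (d1 - d0) rhoV.
have ygH1 := young H d1 rhoV.
have ygH2 := young H d1 theta_gt0.
rewrite !invfM !invrK in ygG ygH1 ygH2.
have lipG' := ler_wpM2l (ltW rho_gt0) lipG.
have lipH1 := ler_wpM2l (ltW rho_gt0) lipH.
have lipH2 : theta^-1 * enorm H ^+ 2 <= theta^-1 * (Ly ^+ 2 * b).
  by rewrite ler_wpM2l // invr_ge0 ltW.
have a0E : a0 = dotv d0 d0 by rewrite /a0 -d0E sqr_enorm.
have a1E : a1 = dotv d1 d1 by rewrite /a1 -d1E sqr_enorm.
rewrite /objective invfM.
move: vi0 vi1 conc mono ygG ygH1 ygH2.
rewrite !sqr_enorm in lipG' lipH1 lipH2 *.
rewrite a0E a1E in lipG' *.
rewrite !dotvE !(dotvC d1 d0) => vi0 vi1 conc mono ygG ygH1 ygH2.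
clear - vi0 vi1 conc mono ygG ygH1 ygH2 lipG' lipH1 lipH2.
split; lra.
Qed.

(** * A decreasing potential *)

Hypothesis Hrho : rho * (4 * Ly ^+ 2) < theta.

(** The coefficient of a0 in the combination of the two conclusions of
    [y_two_steps], the second one taken 4/(theta rho) times. *)
Definition potential_weight : R :=
  (1 + 4 / (theta * rho)) * (rho^-1 / 2 - theta + rho * Ly ^+ 2 / 2).

Definition potential r : R :=
  ell (xs r.+1) (ys r.+1) + potential_weight * enorm (ys r.+1 - ys r) ^+ 2.

(** The multiplier kappa = 4/(theta rho) is as large as the allowed multiple of b
    permits: kappa L_y^2/(2 theta) = 2 L_y^2/(theta^2 rho).  With it, the
    bound rho L_y^2 < theta/4 leaves theta a1 to spare after the potential is
    updated. *)
Lemma potential_y_descent r : (1 <= r)%N ->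
  potential r.+1 + theta * enorm (ys r.+2 - ys r.+1) ^+ 2
  <= ell (xs r.+2) (ys r.+1) + potential_weight * enorm (ys r.+1 - ys r) ^+ 2
     + Ly ^+ 2 * (2 / (theta ^+ 2 * rho) + rho / 2)
       * enorm (xs r.+2 - xs r.+1) ^+ 2.
Proof.
move=> r1; have := y_two_steps r1; rewrite /potential /potential_weight /=.
set a0 := enorm (ys r.+1 - ys r) ^+ 2.
set a1 := enorm (ys r.+2 - ys r.+1) ^+ 2; set b := enorm _ ^+ 2.
have a1_ge0 : 0 <= a1 by exact: sqr_ge0.
move=> [E1 E2].
pose kappa := 4 / (theta * rho).
have k_gt0 : 0 < kappa by rewrite divr_gt0 // mulr_gt0.
have ktheta : kappa * theta = 4 * rho^-1.
  by rewrite /kappa; field; rewrite !lt0r_neq0.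
have E2k := ler_wpM2l (ltW k_gt0) E2.
have kb : kappa * (Ly ^+ 2 / (2 * theta) * b)
          = Ly ^+ 2 * (2 / (theta ^+ 2 * rho)) * b.
  by rewrite /kappa; field; rewrite !lt0r_neq0.
have q_le : rho * Ly ^+ 2 * a1 <= theta / 4 * a1.
  by rewrite ler_wpM2r //; have := Hrho; lra.
have kq_le := ler_wpM2l (ltW k_gt0) q_le.
have kta : kappa * (theta * a1) = 4 * rho^-1 * a1 by rewrite mulrA ktheta.
have rhoV : 0 <= rho^-1 * a1 by rewrite mulr_ge0 // invr_ge0 ltW.
have ta : 0 <= theta * a1 by rewrite mulr_ge0 // ltW.
rewrite -/kappa; lra.
Qed.

(** * Bounding the stationarity gap by the steps *)

Hypothesis beta_gt0 : 0 < beta.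

Definition gap_constant : R :=
  \sum_(i < K) (4 * Lu i ^+ 2 + 4 * Lx i ^+ 2 + 2 * beta ^+ 2)
  + (2 * rho^-1 ^+ 2 + 2 * Ly ^+ 2).

(** By [x_variational] the new block is a proximal point for the gradient of U_i
    plus beta times the step.  Compared with the gradient of f at the new
    iterate, this is off by e1, the variation of the gradient of U_i over the
    step, by e2, the variation of the gradient of f from the partially updated
    iterate to the new one, and by beta times the step. *)
Lemma gap_x_le r (i : 'I_K) : (1 <= r)%N ->
  enorm (beta *: (row i (xs r.+1) - Px X h beta i
     (row i (xs r.+1) - beta^-1 *: gradx f i (xs r.+1) (ys r.+1)))) ^+ 2
  <= (4 * Lu i ^+ 2 + 4 * Lx i ^+ 2 + 2 * beta ^+ 2)
     * (enorm (ys r.+1 - ys r) ^+ 2 + enorm (xs r.+1 - xs r) ^+ 2).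
Proof.
move=> r1; rewrite /Px; set x := xs r.+1; set y := ys r.+1.
have Xm := @iterX r.+1 isT i; have Xp := iterX r1 i.
have Xw := wmix_prodset i r1; have Yy := iterY r1.
have Xx := @iterX r.+1 isT; have Yy' := @iterY r.+1 isT.
have kX : compact (X i) by case: HA.
have := prox_residual_le (gradx f i x y) (@convexX i) kX (@convexh i) beta_gt0 Xm
  (fun z => @x_variational r i z r1).
move=> /le_trans; apply.
set G := grad _; set d := row i x - row i (xs r).
have [e1 e1E] : {e | e = G (row i x) - G (row i (xs r))} by eexists.
have [e2 e2E] : {e | e = gradx f i (wmix r i) (ys r) - gradx f i x y} by eexists.
have B2w := B2 HB i Xw Yy; rewrite row_mixed -/G in B2w.
have -> : G (row i x) + beta *: d - gradx f i x y = (e1 + e2) + beta *: d.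
  by rewrite e1E e2E B2w addrA subrK addrAC.
have dx : enorm d ^+ 2 <= enorm (x - xs r) ^+ 2.
  by rewrite /d -raddfB sqr_enorm_row_le.
have le1 : enorm e1 ^+ 2 <= Lu i ^+ 2 * enorm d ^+ 2.
  rewrite e1E; have := B4 HB Xw Yy Xp Xm; rewrite -/G.
  move=> /(sqr_lipschitz (enorm_ge0 _)).
  by rewrite -[row i (xs r) - _]opprB enormN.
have le2 : enorm e2 ^+ 2
    <= Lx i ^+ 2 * (enorm (y - ys r) ^+ 2 + enorm (x - xs r) ^+ 2).
  rewrite e2E; have := A3_x HA Xx Xw Yy' Yy i.
  move=> /(sqr_lipschitz (enorm_ge0 _)) /le_trans; apply.
  rewrite ler_wpM2l ?sqr_ge0 // sqr_pnorm /= addrC lerD ?enorm_mixedB_le //.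
  by rewrite -[ys r - _]opprB enormN.
have := sqr_enormD_le (e1 + e2) (beta *: d).
have := sqr_enormD_le e1 e2.
have -> : enorm (beta *: d) ^+ 2 = beta ^+ 2 * enorm d ^+ 2.
  by rewrite enormZ exprMn real_normK // num_real.
have d1 := ler_wpM2l (sqr_ge0 (Lu i)) dx; have d2 := ler_wpM2l (sqr_ge0 beta) dx.
have a0 := sqr_ge0 (enorm (y - ys r)).
have d3 := mulr_ge0 (sqr_ge0 (Lu i)) a0; have d4 := mulr_ge0 (sqr_ge0 beta) a0.
lra.
Qed.

Lemma PyE v : Py Y g rho v
  = get (argmin Y (fun z => g z + rho^-1 / 2 * enorm (z - v) ^+ 2)).
Proof.
rewrite /Py; congr get; apply/seteqP; split=> w [Yw wopt]; split=> // b Yb;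
  have := wopt b Yb; rewrite invfM; lra.
Qed.

Lemma gap_y_le r : (1 <= r)%N ->
  enorm (rho^-1 *: (ys r.+1
     - Py Y g rho (ys r.+1 + rho *: grady f (xs r.+1) (ys r.+1)))) ^+ 2
  <= (2 * rho^-1 ^+ 2 + 2 * Ly ^+ 2) * enorm (ys r.+1 - ys r) ^+ 2.
Proof.
move=> r1; rewrite PyE; set x := xs r.+1; set y := ys r.+1.
have Yp := iterY r1; have Ym := @iterY r.+1 isT; have Xx := @iterX r.+1 isT.
have kY : compact Y by case: HA.
have rhoV : 0 < rho^-1 by rewrite invr_gt0.
have := prox_residual_le (- grady f x y) convexY kY convexg rhoV Ym
  (fun v => @y_variational r v r1).
rewrite invrK scalerN opprK => /le_trans; apply.
rewrite opprK -addrA [- _ + _]addrC.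
apply: le_trans (sqr_enormD_le _ _) _.
have := grady_sqr_lipschitz Xx Xx Yp Ym.
rewrite subrr enorm0 expr0n add0r enormZ exprMn real_normK ?num_real //; lra.
Qed.

Lemma gap_le r : (1 <= r)%N ->
  pnorm (gap X Y f h g beta rho (xs r.+1) (ys r.+1)) ^+ 2
  <= gap_constant * (enorm (ys r.+1 - ys r) ^+ 2 + enorm (xs r.+1 - xs r) ^+ 2).
Proof.
move=> r1; rewrite sqr_pnorm /= sqr_enorm_rows /gap_constant mulrDl mulr_suml.
apply: lerD.
  apply: ler_sum => i _; apply: le_trans (gap_x_le i r1).
  by rewrite le_eqVlt; apply/orP; left; apply/eqP; congr (enorm _ ^+ 2);
     apply/rowP => k; rewrite !mxE.
apply: le_trans (gap_y_le r1) _; rewrite ler_wpM2l ?lerDl ?sqr_ge0 //.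
by rewrite addr_ge0 // mulr_ge0 ?sqr_ge0.
Qed.

(** * Summability of the squared gaps *)

Hypothesis Hbeta : forall i,
  Ly ^+ 2 * (2 / (theta ^+ 2 * rho) + rho / 2) + Lx i / 2 - mu i < beta.

(** Capped at 1 so that the empty family has a bound too. *)
Lemma finite_positive_lower_bound n (c : 'I_n -> R) :
  (forall i, 0 < c i) -> exists2 s, 0 < s & forall i, s <= c i.
Proof.
move=> c0; exists (\big[Num.min/1]_(i < n) c i).
  by elim/big_ind: _ => // a b a0 b0; rewrite lt_min a0.
by move=> i; exact: bigmin_le_cond.
Qed.

(** The x-descent absorbs the multiple of b in [potential_y_descent], and the
    strict lower bound on beta leaves a positive multiple of b. *)
Lemma potential_descent : exists2 s, 0 < s & forall r, (1 <= r)%N ->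
  potential r.+1 + s * (enorm (ys r.+2 - ys r.+1) ^+ 2
                        + enorm (xs r.+2 - xs r.+1) ^+ 2) <= potential r.
Proof.
pose q := Ly ^+ 2 * (2 / (theta ^+ 2 * rho) + rho / 2).
have [i|s s_gt0 s_le] := @finite_positive_lower_bound K
    (fun i => beta + mu i - Lx i / 2 - q).
  by have := Hbeta i; rewrite -/q; lra.
exists (Num.min s theta) => [|r r1]; first by rewrite lt_min s_gt0.
have := potential_y_descent r1; rewrite -/q.
have := @x_descent r.+1 isT; rewrite [potential r]/potential.
set b := enorm (xs r.+2 - xs r.+1) ^+ 2; set a := enorm (ys r.+2 - _) ^+ 2.
have : (s + q) * b <= \sum_(i < K) (beta + mu i - Lx i / 2)
                   * enorm (row i (xs r.+2 - xs r.+1)) ^+ 2.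
  rewrite /b sqr_enorm_rows mulr_sumr; apply: ler_sum => i _.
  by rewrite ler_wpM2r ?sqr_ge0 //; have := s_le i; lra.
have : Num.min s theta * a <= theta * a.
  by rewrite ler_wpM2r ?sqr_ge0 // ge_min lexx orbT.
have : Num.min s theta * b <= s * b by rewrite ler_wpM2r ?sqr_ge0 // ge_min lexx.
lra.
Qed.

Lemma potential_lower : exists l, forall r, (1 <= r)%N -> l <= potential r.
Proof.
have [l l_le] := A1_lower HA; exists l => r r1.
have Xx := @iterX r.+1 isT; have Yy := @iterY r.+1 isT.
apply: le_trans (l_le _ _ Xx Yy) _; rewrite lerDl -[leRHS]mulrA.
apply: mulr_ge0; last exact: (y_curvature_ge0 Xx (iterY r1) Yy).
by rewrite addr_ge0 // divr_ge0 // ltW // mulr_gt0.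
Qed.

(** The sum starts at the gap of (x^3, y^3): the potential involves a previous
    y-step, so its decrease controls the steps from the second iteration on. *)
Lemma gap_square_summable : exists D, forall n,
  \sum_(k < n) pnorm (gap X Y f h g beta rho (xs k.+3) (ys k.+3)) ^+ 2 <= D.
Proof.
have [s s_gt0 desc] := potential_descent; have [l low] := potential_lower.
have C_ge0 : 0 <= gap_constant.
  by rewrite addr_ge0 ?sumr_ge0 // => [i _|]; rewrite ?addr_ge0 // mulr_ge0 ?sqr_ge0.
have Cs_ge0 : 0 <= gap_constant / s by rewrite divr_ge0 // ltW.
exists (gap_constant / s * (potential 1 - l)) => n.
suff : \sum_(k < n) pnorm (gap X Y f h g beta rho (xs k.+3) (ys k.+3)) ^+ 2
    <= gap_constant / s * (potential 1 - potential n.+1).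
  move=> /le_trans; apply; rewrite ler_wpM2l // lerD2l lerN2; exact: low.
elim: n => [|n IHn]; first by rewrite big_ord0 subrr mulr0.
rewrite big_ord_recr /=; apply: le_trans (lerD IHn (@gap_le n.+2 isT)) _.
have := ler_wpM2l Cs_ge0 (desc n.+1 isT).
set e := enorm (ys n.+3 - _) ^+ 2 + _; rewrite mulrDr mulrA divfK ?gt_eqF //.
lra.
Qed.

End Iteration.

(** * From summability to a hitting time *)

Section Complexity.
Variable R : realType.

(** If the first n + 1 terms all exceeded eps, with n the integer part of
    D/eps^2, their squares would add up to more than D. *)
Lemma small_term_of_sum_le (u : nat -> R) (D eps : R) :
  (forall n, \sum_(k < n) u k ^+ 2 <= D) -> 0 < eps -> (forall k, 0 <= u k) ->
  exists2 k, k%:R <= D / eps ^+ 2 & u k <= eps.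
Proof.
move=> uD eps0 u0; have eps2 : 0 < eps ^+ 2 by rewrite exprn_gt0.
have D0 : 0 <= D by have := uD 0%N; rewrite big_ord0.
pose n := Num.truncn (D / eps ^+ 2).
have /andP[nle nlt] : n%:R <= D / eps ^+ 2 < n.+1%:R.
  by apply: truncn_itv; rewrite divr_ge0 // ltW.
have [|big] := pselect (exists2 k, (k < n.+1)%N & u k <= eps).
  move=> [k kn uk]; exists k => //; apply: le_trans nle.
  by rewrite ler_nat -ltnS.
move: nlt; rewrite ltNge => /negP; case; rewrite ler_pdivlMr //.
apply: le_trans (uD n.+1); rewrite mulr_natl -[X in _ *+ X]card_ord -sumr_const.
apply: ler_sum => k _; rewrite ler_pXn2r ?nnegrE ?(ltW eps0) //.
by rewrite leNgt; apply/negP => /ltW uk; apply: big; exists k.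
Qed.

Lemma least_exists (P : set nat) t : P t -> exists2 m, least P m & (m <= t)%N.
Proof.
move=> Pt; have exP : exists n, `[< P n >] by exists t; apply/asboolP.
have [m /asboolP Pm mle] := find_ex_minn exP.
by exists m; [split=> // r Pr|]; apply: mle; apply/asboolP.
Qed.

(** The bound D/eps^2 + 2 on the hitting time holds for every eps > 0; it is at
    most (D + 2)/eps^2 as soon as eps <= 1. *)
Lemma hitting_time_bigO (u : nat -> R) (D : R) :
  (forall k, 0 <= u k) -> (forall n, \sum_(k < n) u k.+2 ^+ 2 <= D) ->
  exists T : R -> nat,
    (forall eps, 0 < eps -> least [set r | (1 <= r)%N /\ u r <= eps] (T eps)) /\
    (fun eps => (T eps)%:R : R) =O_ (0^'+) (fun eps => eps ^- 2).
Proof.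
move=> u0 uD.
have hit eps : {t | 0 < eps -> least [set r | (1 <= r)%N /\ u r <= eps] t
                    /\ t%:R <= D / eps ^+ 2 + 2}.
  apply: cid; have [eps0|_] := ltP 0 eps; last by exists 0%N.
  have [k kle uk] := small_term_of_sum_le uD eps0 (fun k => u0 k.+2).
  have Pk : [set r | (1 <= r)%N /\ u r <= eps] k.+2 by [].
  have [m mleast mle] := least_exists Pk; exists m => _; split=> //.
  apply: (@le_trans _ _ k.+2%:R); first by rewrite ler_nat.
  by rewrite -addn2 natrD lerD2r.
exists (fun eps => sval (hit eps)); split=> [eps eps0|].
  by case: (hit eps) => t /= /(_ eps0)[].
have D0 : 0 <= D by have := uD 0%N; rewrite big_ord0.
apply/eqO_exP; exists (D + 2); first by rewrite ltr_wpDl.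
near=> eps; have eps0 : 0 < eps by near: eps; exact: nbhs_right_gt.
have eps1 : eps <= 1 by near: eps; exact: nbhs_right_le.
case: (hit eps) => t /= /(_ eps0)[_ tle].
rewrite !ger0_norm ?invr_ge0 ?exprn_ge0 ?(ltW eps0) //.
apply: le_trans tle _; rewrite mulrDl lerD2l ler_peMr //.
by rewrite invf_ge1 ?exprn_gt0 // exprn_ile1 // ltW.
Unshelve. all: by end_near. Qed.

End Complexity.

(** * The iteration complexity *)

Theorem theorem1 (R : realType) (K N M : nat)
    (X : 'I_K -> set 'rV[R]_N) (Y : set 'rV[R]_M)
    (f : 'M[R]_(K, N) * 'rV[R]_M -> R)
    (h : 'I_K -> 'rV[R]_N -> R) (g : 'rV[R]_M -> R)
    (Lx : 'I_K -> R) (Ly : R)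
    (U : 'I_K -> 'rV[R]_N -> 'M[R]_(K, N) -> 'rV[R]_M -> R)
    (mu Lu : 'I_K -> R) (theta rho beta : R)
    (xs : nat -> 'M[R]_(K, N)) (ys : nat -> 'rV[R]_M) :
  assumptionA X Y f h g Lx Ly ->
  assumptionB X Y f U mu Lu ->
  assumptionC1 X Y f theta rho ->
  0 < beta ->
  HiBSA X Y h g U (Uy_C1 f rho) (fun=> beta) (fun=> 0) xs ys ->
  (* rho < theta / (4 Ly^2), read as no restriction when Ly = 0 *)
  rho * (4 * Ly ^+ 2) < theta ->
  (forall i, Ly ^+ 2 * (2 / (theta ^+ 2 * rho) + rho / 2) + Lx i / 2 - mu i
               < beta) ->
  exists T : R -> nat,
    (forall eps, 0 < eps ->
       least [set r | (1 <= r)%N /\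
                pnorm (gap X Y f h g beta rho (xs r.+1) (ys r.+1)) <= eps]
             (T eps)) /\
    (fun eps => (T eps)%:R : R) =O_ (0^'+) (fun eps => eps ^- 2).
Proof.
move=> HA HB HC beta0 Halg Hrho Hbeta.
have [D sumD] := gap_square_summable HA HB HC Halg Hrho beta0 Hbeta.
exact: (hitting_time_bigO (fun r => pnorm_ge0 _) sumD).
Qed.
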